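(* There exist finitely generated torsion groups $\Gamma$ with $\mathrm{Lit}(\Gamma)=\infty$.
   Context: $T_1(\Gamma)$ is the space of all $f\colon\Gamma\to\mathbf{C}$ for which there exist $f_1,f_2\colon\Gamma\times\Gamma\to\mathbf{C}$ with $f(x^{-1}y)=f_1(x,y)+f_2(x,y)$ for all $x,y\in\Gamma$, $\sup_x\sum_y|f_1(x,y)|<\infty$ and $\sup_y\sum_x|f_2(x,y)|<\infty$. $\mathrm{Lit}(\Gamma)=\inf\{p>0: T_1(\Gamma)\subseteq\ell^p(\Gamma)\}\in[0,\infty]$. A torsion group is one in which every element has finite order. *)

(* Defs.v *)
From HB Require Import structures.
From mathcomp Require Import all_boot all_order all_algebra.
From mathcomp Require Import monoid.
From mathcomp Require Import all_classical all_reals all_analysis.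
From mathcomp Require Import Rstruct.
From mathcomp Require Import complex.

Set Implicit Arguments.
Unset Strict Implicit.
Unset Printing Implicit Defensive.

Import Order.TTheory GRing.Theory Num.Theory.
Local Open Scope ring_scope.

Notation RR := Rdefinitions.R.
Notation CC := (complex.complex RR).

Definition cmod (z : CC) : RR :=
  Num.sqrt (complex.Re z ^+ 2 + complex.Im z ^+ 2).

Section GroupNotions.
Variable G : groupType.

Definition generated_by (s : seq G) (x : G) : Prop :=
  exists w : seq G,
    all (fun g => (g \in s) || (g^-1 \in s))%g w /\ x = (\prod_(g <- w) g)%g.

Definition finitely_generated : Prop :=
  exists s : seq G, forall x : G, generated_by s x.

Definition torsion_group : Prop :=
  forall x : G, exists n : nat, (0 < n)%N /\ (x ^+ n)%g = 1%g.

(* sum over T of the nonnegative function a is finite: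
   all finite partial sums are bounded *)
Definition finite_sum {T : eqType} (a : T -> RR) : Prop :=
  exists M : RR, forall s : seq T, uniq s -> \sum_(y <- s) a y <= M.

Definition unif_finite_sum {I T : eqType} (a : I -> T -> RR) : Prop :=
  exists M : RR, forall (i : I) (s : seq T), uniq s -> \sum_(y <- s) a i y <= M.

Definition T1 (f : G -> CC) : Prop :=
  exists f1 f2 : G -> G -> CC,
    (forall x y : G, f (x^-1 * y)%g = f1 x y + f2 x y) /\
    unif_finite_sum (fun x y => cmod (f1 x y)) /\
    unif_finite_sum (fun y x => cmod (f2 x y)).

Definition lp (p : RR) (f : G -> CC) : Prop :=
  finite_sum (fun y => powR (cmod (f y)) p).

Definition Lit : \bar RR :=
  ereal_inf [set (p%:E) | p in [set p : RR | 0 < p /\ forall f, T1 f -> lp p f]].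

End GroupNotions.

(* Main.v *)
(* Every positive word [w] in two letters gets an exponent [2 ^ e], the inverses
   of these exponents summing to at most [1/2]; the group is the largest
   residually finite quotient of the free monoid in which each [w] is killed
   by its exponent.

   Cocycles.  On a finite set [Q] with an action of the group, a cocycle with
   values in F_2 is free on the [2 |Q|] edges, and the relator of [w] only
   constrains it on the [w]-orbits whose size is the full exponent of [w]: on a
   shorter orbit the cocycle is summed an even number of times.  So the
   cocycles have dimension at least [3/2 |Q|] (the p-deficiency argument of
   Schlage-Puchta).  A cocycle which is not a coboundary yields a
   connected double cover, hence finite orbits of all sizes [2 ^ k].

   Random forests.  Let [m = 2 ^ k] be the size of an orbit and let [S] be the
   [2 m] Schreier generators of a point stabiliser.  Restricting the cocycles of
   [U * orbit], [U] a finite action, to [U * S] gives a space of dimension at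
   least [m |U| / 2], hence a set [K] of that many edges on which cocycles take
   arbitrary values.  For [u] in [U] draw the edge [g, g s] when [(u g, s)] is
   in [K].  As cocycles sum to zero along cycles, this graph is a forest wherever
   the orbit map of [u] is injective, so its edges can be charged injectively to
   endpoints.  Averaging over [u] gives a function with T_1-constants 1,
   supported on [2 m] elements and of sum at least [m / 2].  A generalized limit
   over larger and larger [U], weighted by [2 ^ -j] for [m = 2 ^ (j * j)], yields
   one element of T_1 which lies in no l^p. *)
Require Import Defs.
From HB Require Import structures.
From mathcomp Require Import all_boot all_order all_algebra.
From mathcomp Require Import monoid fingroup perm generic_quotient.
From mathcomp Require Import all_classical all_reals all_analysis.
From mathcomp Require Import Rstruct complex zify ring lra.

Set Implicit Arguments.
Unset Strict Implicit.
Unset Printing Implicit Defensive.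

Import Order.TTheory GRing.Theory Num.Theory.
Import numFieldNormedType.Exports.
Local Open Scope ring_scope.

(** * Actions of words and their cocycles *)

Definition act (T : Type) (a : bool -> T -> T) (t : T) (w : seq bool) : T :=
  foldl (fun t b => a b t) t w.

Definition wpow (w : seq bool) (n : nat) : seq bool := flatten (nseq n w).

(** [pickle] is injective, so the inverses of the exponents sum to at most 1/4 + 1/8 + ... = 1/2. *)
Definition wexp (w : seq bool) : nat := (2 ^ (pickle w).+2)%N.

Definition winv (w : seq bool) : seq bool := wpow w (wexp w).-1.

(* Since words have finite exponents, positive words suffice to form a group. *)
Definition good (T : Type) (a : bool -> T -> T) : Prop :=
  forall w t, act a t (wpow w (wexp w)) = t.

Lemma wexp_gt0 w : (0 < wexp w)%N.
Proof. by rewrite expn_gt0. Qed.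

Lemma wpowS w n : wpow w n.+1 = w ++ wpow w n.
Proof. by []. Qed.

Lemma wpowD w m n : wpow w (m + n) = wpow w m ++ wpow w n.
Proof. by rewrite /wpow nseqD flatten_cat. Qed.

Lemma wpow1 w : wpow w 1 = w.
Proof. by rewrite /wpow /= cats0. Qed.

Lemma cat_winv w : w ++ winv w = wpow w (wexp w).
Proof. by rewrite -wpowS prednK ?wexp_gt0. Qed.

Lemma winv_cat w : winv w ++ w = wpow w (wexp w).
Proof. by rewrite -[X in _ ++ X]wpow1 -wpowD addn1 prednK ?wexp_gt0. Qed.

Lemma addrrF2 (x : 'F_2) : x + x = 0.
Proof. exact: (addrr_pchar2 (pchar_Fp (isT : prime 2))). Qed.

Lemma leq_dyadic_sum (r : nat -> nat) (k n : nat) :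
  (forall i, (i < k)%N -> (r i * 2 ^ i.+2 <= n)%N) ->
  (2 * \sum_(i < k) r i <= n)%N.
Proof.
(* With S the sum, this is [2 * S <= n * (1 - 2 ^ -k)] cleared of denominators; keeping the exact
   geometric sum makes the induction close. *)
move=> rn; suff : (2 ^ k * (2 * \sum_(i < k) r i) + n <= n * 2 ^ k)%N.
  have := expn_gt0 2 k; nia.
elim: k rn => [|k IHk] rn; first by rewrite big_ord0; lia.
have {}IHk := IHk (fun i ik => rn i (ltnW ik)).
have := rn k (ltnSn k); rewrite big_ord_recr /= !expnS.
by move: IHk; move: (\sum_(i < k) r i)%N (2 ^ k)%N => S P; nia.
Qed.

Section Actions.
Variables (T : Type) (a : bool -> T -> T).

Lemma act_cat t u v : act a t (u ++ v) = act a (act a t u) v.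
Proof. exact: foldl_cat. Qed.

Lemma act_wpow t w n : act a t (wpow w n) = iter n (act a ^~ w) t.
Proof. by elim: n t => // n IHn t; rewrite wpowS act_cat IHn iterSr. Qed.

Hypothesis aG : good a.

Lemma act_winvK w : cancel (act a ^~ w) (act a ^~ (winv w)).
Proof. by move=> t; rewrite -act_cat cat_winv aG. Qed.

Lemma act_winvVK w : cancel (act a ^~ (winv w)) (act a ^~ w).
Proof. by move=> t; rewrite -act_cat winv_cat aG. Qed.

Lemma act_inj w : injective (act a ^~ w).
Proof. exact: can_inj (act_winvK w). Qed.

Lemma act_bij w : bijective (act a ^~ w).
Proof. by exists (act a ^~ (winv w)); [exact: act_winvK | exact: act_winvVK]. Qed.

End Actions.

Section Cocycles.
Variables (T : finType) (a : bool -> T -> T).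
Implicit Types (c : {ffun T * bool -> 'F_2}) (t : T) (w : seq bool).

Fixpoint cext c t w : 'F_2 :=
  if w is b :: w' then c (t, b) + cext c (a b t) w' else 0.

Definition goodc c : Prop := forall w t, cext c t (wpow w (wexp w)) = 0.

Definition cocycles : {set {ffun T * bool -> 'F_2}} :=
  finset (fun c => `[< goodc c >]).

(** The double cover of the Schreier graph of [a] with voltage assignment [c]. *)
Definition twist c (b : bool) (p : T * 'F_2) : T * 'F_2 :=
  (a b p.1, p.2 + c (p.1, b)).

Lemma cext_cat c t u v : cext c t (u ++ v) = cext c t u + cext c (act a t u) v.
Proof. by elim: u t => [|b u IHu] t /=; rewrite ?add0r // IHu addrA. Qed.

Lemma cextB c c' t w : cext (c - c') t w = cext c t w - cext c' t w.
Proof.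
elim: w t => [|b w IHw] t /=; first by rewrite subr0.
by rewrite IHw !ffunE opprD addrACA.
Qed.

Lemma act_twist c p w :
  act (twist c) p w = (act a p.1 w, p.2 + cext c p.1 w).
Proof.
elim: w p => [|b w IHw] [t v] /=; first by rewrite addr0.
by rewrite IHw /= addrA.
Qed.

Lemma good_twist c : good a -> goodc c -> good (twist c).
Proof. by move=> aG cG w [t v]; rewrite act_twist /= aG cG addr0. Qed.

Lemma cocyclesP c : reflect (goodc c) (c \in cocycles).
Proof. by rewrite inE; exact: asboolP. Qed.

Lemma cext_wpow_mul c t w m n : act a t (wpow w m) = t ->
  cext c t (wpow w (n * m)) = cext c t (wpow w m) *+ n.
Proof.
move=> tm; elim: n => [|n IHn]; first by rewrite mul0n mulr0n.
by rewrite mulSn wpowD cext_cat tm IHn mulrS.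
Qed.

Hypothesis aG : good a.

Lemma order_dvd_wexp w t : (fingraph.order (act a ^~ w) t %| wexp w)%N.
Proof.
set f := act a ^~ w; set o := fingraph.order f t.
have o0 : (0 < o)%N by exact: fingraph.order_gt0.
have it q r : iter (q * o + r) f t = iter r f t.
  elim: q => [//|q IHq].
  by rewrite mulSn -addnA addnC iterD iter_order //; exact: act_inj.
have := aG w t; rewrite act_wpow (divn_eq (wexp w) o) it => tr.
have ro : (wexp w %% o < o)%N by rewrite ltn_mod.
apply/eqP.
have := nth_uniq t (i := (wexp w %% o)%N) (j := 0%N) _ _ (orbit_uniq f t).
rewrite size_orbit -/o => /(_ ro o0); rewrite /orbit !nth_traject // tr eqxx.
by rewrite -divn_eq => /esym/eqP.
Qed.

Lemma cext_short_orbit c w t : (fingraph.order (act a ^~ w) t < wexp w)%N ->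
  cext c t (wpow w (wexp w)) = 0.
Proof.
move=> ltoN; have dN := order_dvd_wexp w t; move: ltoN.
set o := fingraph.order _ _ in dN *.
have /(dvdn_pfactor _ _ (isT : prime 2))[k kle ok] : (o %| 2 ^ (pickle w).+2)%N by [].
rewrite /wexp ok ltn_exp2l // => ltk.
have -> : (2 ^ (pickle w).+2 = (2 * 2 ^ ((pickle w).+2 - k).-1) * 2 ^ k)%N.
  by rewrite -expnS prednK ?subn_gt0 // -expnD subnK.
rewrite cext_wpow_mul; last by rewrite -ok act_wpow iter_order //; exact: act_inj.
by rewrite mulrnA mulr2n addrrF2 mul0rn.
Qed.

(** Reading [w] [k] times before or after the relator gives the same total, and the relator returns
    to its starting point; one condition per orbit therefore suffices. *)
Lemma cext_wexp_orbit c w t k :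
  cext c (iter k (act a ^~ w) t) (wpow w (wexp w)) = cext c t (wpow w (wexp w)).
Proof.
have := cext_cat c t (wpow w k) (wpow w (wexp w)).
rewrite -wpowD addnC wpowD cext_cat aG act_wpow addrC => /addrI.
by [].
Qed.

(* Only the orbits of [w] of size exactly [wexp w] impose a condition on a
   cocycle (in characteristic 2 the others give an even multiple), and they
   are at most [#|T| / wexp w] in number. *)
Lemma card_cocycles : exists P : nat,
  (2 * P <= #|T|)%N /\ (2 ^ (2 * #|T|) <= #|cocycles| * 2 ^ P)%N.
Proof.
pose n := #|T|.
pose Q : {set 'I_n * T} := finset (fun p : 'I_n * T =>
  if pickle_inv (nat_of_ord p.1) is Some w then
    (p.2 \in froots (act a ^~ w)) &&
      (fingraph.order (act a ^~ w) p.2 == wexp w)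
  else false).
pose ev c : {ffun {p : 'I_n * T | p \in Q} -> 'F_2} := [ffun p =>
  if pickle_inv (nat_of_ord (val p).1) is Some w
  then cext c (val p).2 (wpow w (wexp w)) else 0].
have evG c : ev c = 0 -> goodc c.
  move=> /ffunP ev0 w t; set f := act a ^~ w.
  have := dvdn_leq (wexp_gt0 w) (order_dvd_wexp w t); rewrite leq_eqVlt.
  case/orP=> [/eqP oN|]; last exact: cext_short_orbit.
  have fS : connect_sym (frel f) by apply: fconnect_sym; exact: act_inj.
  (* A full orbit has [wexp w] points, so only words with code below [#|T|] matter, which is why [Q]
     can be finite. *)
  have pn : (pickle w < n)%N.
    have : (wexp w <= n)%N by rewrite -oN; exact: max_card.
    apply: leq_trans; apply: leq_trans (ltn_expl _ (ltnSn 1)) _.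
    by rewrite leq_exp2l // -addn2 leq_addr.
  have rt := connect_root (frel f) t.
  have /iter_findex <- : fconnect f (froot f t) t by rewrite fS.
  rewrite cext_wexp_orbit.
  have pQ : (Ordinal pn, froot f t) \in Q.
    rewrite inE /= pickleK_inv; apply/andP; split; first exact: roots_root.
    by rewrite -oN; apply/eqP/esym/eq_card => y; exact: same_connect.
  by have := ev0 (exist (fun p => p \in Q) _ pQ); rewrite !ffunE /= pickleK_inv.
exists #|Q|; split.
  pose r (i : nat) := #|[set t | if pickle_inv i is Some w then
    (t \in froots (act a ^~ w)) && (fingraph.order (act a ^~ w) t == wexp w)
    else false]%SET|.
  have -> : #|Q| = (\sum_(i < n) r i)%N.
    pose A (i : 'I_n) t := if pickle_inv (nat_of_ord i) is Some w then
        (t \in froots (act a ^~ w)) && (fingraph.order (act a ^~ w) t == wexp w)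
        else false.
    rewrite (eq_bigr (fun i => \sum_(t | A i t) 1)%N); last first.
      by move=> i _; rewrite /r -sum1_card; apply: eq_bigl => t; rewrite inE.
    by rewrite pair_big_dep -sum1_card; apply: eq_bigl => p; rewrite inE.
  apply: leq_dyadic_sum => i _; rewrite /r.
  have := @pickle_invK (seq bool) i; case: pickle_inv => [w /= E|_]; last first.
    by rewrite eq_card0 // => t; rewrite !inE.
  set f := act a ^~ w; have fI : injective f by exact: act_inj.
  rewrite -E -/(wexp w).
  have <- : fcard f (order_set f (wexp w)) =
      #|[set t | (t \in froots f) && (fingraph.order f t == wexp w)]%SET|.
    by apply: eq_card => t; rewrite !inE.
  rewrite fcard_order_set ?max_card // => t t' /eqP <-.
  rewrite !inE; congr (_ == _); apply: eq_card => y.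
  exact: (same_fconnect1 fI).
pose C := {ffun T * bool -> 'F_2}.
pose rep y : C := odflt 0 [pick c | ev c == y].
have repE c : ev (rep (ev c)) = ev c.
  by rewrite /rep; case: pickP => [c' /eqP //|/(_ c)]; rewrite eqxx.
(* Subtracting a chosen preimage of [ev c] lands in the kernel of [ev], which consists of cocycles;
   [h] is rank-nullity written as an injection. *)
pose h c := (c - rep (ev c), ev c).
have hI : injective h by move=> c c' [+ e]; rewrite e => /addIr.
have -> : (2 ^ (2 * n))%N = #|h @: [set: C]%SET|.
  rewrite card_imset // cardsT card_ffun card_prod card_bool card_Fp //.
  by rewrite mulnC.
have -> : (2 ^ #|Q|)%N = #|[set: {ffun {p | p \in Q} -> 'F_2}]%SET|.
  by rewrite cardsT card_ffun card_Fp // card_sig; congr (_ ^ _)%N; apply: eq_card.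
rewrite -cardsX; apply/subset_leq_card/fintype.subsetP => _ /imsetP[c _ ->].
rewrite !inE andbT; apply/asboolP/evG/ffunP => p.
have /ffunP/(_ p) := repE c; rewrite !ffunE.
by case: pickle_inv => // w; rewrite cextB => ->; rewrite subrr.
Qed.

End Cocycles.

(** * Finite actions *)

Definition reaches_all (T : Type) (a : bool -> T -> T) (t0 : T) : Prop :=
  forall t, exists w, act a t0 w = t.

Lemma F2_cases (x y z : 'F_2) : x != y -> z = x \/ z = y.
Proof.
case: x y z => [[|[|//]] ?] [[|[|//]] ?] [[|[|//]] ?] //= _;
  by [left; apply/val_inj|right; apply/val_inj].
Qed.

Section Doubling.
Variables (T : finType) (a : bool -> T -> T) (t0 : T).
Hypotheses (aG : good a) (aT : reaches_all a t0).

(** Counting: at most [2 ^ #|T|] coboundaries against at least [2 ^ (2 * #|T| - P)] cocycles with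
    [2 * P <= #|T|], and [T] is nonempty. *)
Lemma exists_noncoboundary : exists2 c : {ffun T * bool -> 'F_2}, goodc a c &
  forall psi : T -> 'F_2, exists p, c p != psi (a p.2 p.1) - psi p.1.
Proof.
pose d (psi : {ffun T -> 'F_2}) : {ffun T * bool -> 'F_2} :=
  [ffun p => psi (a p.2 p.1) - psi p.1].
have [P [P2 cP]] := card_cocycles aG.
have T0 : (0 < #|T|)%N by apply/card_gt0P; exists t0.
have : ~~ (cocycles a \subset d @: [set: {ffun T -> 'F_2}]%SET).
  apply/negP => /subset_leq_card; apply/negP; rewrite -ltnNge.
  apply: (leq_ltn_trans (leq_imset_card _ _)).
  rewrite cardsT card_ffun card_Fp //.
  rewrite -(ltn_pmul2r (expn_gt0 2 P)); apply: leq_trans cP.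
  by rewrite -expnD ltn_exp2l //; lia.
case/subsetPn => c /cocyclesP cG nc; exists c => // psi.
case: (pickP (fun p => c p != psi (a p.2 p.1) - psi p.1)) => [p|cE]; first by exists p.
case/imsetP: nc; exists (finfun psi) => //; apply/ffunP => p.
by rewrite !ffunE; apply/eqP; have /negbFE := cE p.
Qed.

(** If only one point over each [t] were reachable, this lift would write [c] as a coboundary.
    Otherwise some fibre is reached entirely, and paths carry both of its points to any other
    fibre. *)
Lemma double_reaches_all : exists2 c, goodc a c & reaches_all (twist a c) (t0, 0).
Proof.
have [c cG ncob] := exists_noncoboundary; exists c => //.
pose reach p := exists w, act (twist a c) (t0, 0) w = p.
have reach_act p w : reach p -> reach (act (twist a c) p w).
  by case=> v <-; exists (v ++ w); rewrite act_cat.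
have [f fE] := choice aT; pose psi t := cext a c t0 (f t).
have rpsi t : reach (t, psi t) by exists (f t); rewrite act_twist /= fE add0r.
have [[t [v [rtv vn]]] | uniq_lift] :=
  pselect (exists t v, reach (t, v) /\ v != psi t); last first.
  have [[t b] /= /negP[]] := ncob psi; apply/eqP/esym/eqP.
  rewrite subr_eq addrC eq_sym; apply: contrapT => /negP ne; apply: uniq_lift.
  exists (a b t), (psi t + c (t, b)); split=> //.
  by have := reach_act _ [:: b] (rpsi t); rewrite act_twist /= addr0.
move=> [t' v'] /=; change (reach (t', v')).
have [w tw] : exists w, act a t w = t'.
  by exists (winv (f t) ++ f t'); rewrite act_cat -{1}[t]fE act_winvK ?fE.
have := F2_cases (v' - cext a c t w) vn.
by case=> /eqP; rewrite subr_eq => /eqP ->;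
  [have := reach_act _ w rtv | have := reach_act _ w (rpsi t)];
  rewrite act_twist /= tw.
Qed.

End Doubling.

Lemma exists_large_orbit (k : nat) : exists (T : finType) (a : bool -> T -> T) (t0 : T),
  [/\ good a, reaches_all a t0 & #|T| = (2 ^ k)%N].
Proof.
elim: k => [|k [T [a [t0 [aG aT cT]]]]].
  exists unit, (fun _ t => t), tt; split; last exact: card_unit.
    by move=> w t; case: (act _ _ _); case: t.
  by move=> []; exists [::].
have [c cG cA] := double_reaches_all aG aT.
exists (T * 'F_2)%type, (twist a c), (t0, 0); split=> //; first exact: good_twist.
by rewrite card_prod cT card_Fp // expnSr.
Qed.

(** Equality in the residually finite quotient: only finite actions are tested. *)
Definition eqw (u v : seq bool) : Prop :=
  forall (T : finType) (a : bool -> T -> T) t, good a -> act a t u = act a t v.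

Section Sum.
Variables (T1 T2 : Type) (a1 : bool -> T1 -> T1) (a2 : bool -> T2 -> T2).

Definition sum_act (b : bool) (t : T1 + T2) : T1 + T2 :=
  match t with inl t1 => inl (a1 b t1) | inr t2 => inr (a2 b t2) end.

Lemma act_sum t w : act sum_act t w =
  match t with inl t1 => inl (act a1 t1 w) | inr t2 => inr (act a2 t2 w) end.
Proof. by elim: w t => [|b w IHw] [t|t] //=; rewrite IHw. Qed.

Lemma good_sum : good a1 -> good a2 -> good sum_act.
Proof. by move=> G1 G2 w [t|t]; rewrite act_sum ?G1 ?G2. Qed.

Definition prod_act (b : bool) (t : T1 * T2) : T1 * T2 := (a1 b t.1, a2 b t.2).

Lemma act_prod t w : act prod_act t w = (act a1 t.1 w, act a2 t.2 w).
Proof. by elim: w t => [|b w IHw] [t1 t2] //=; rewrite IHw. Qed.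

Lemma good_prod : good a1 -> good a2 -> good prod_act.
Proof. by move=> G1 G2 w [t1 t2]; rewrite act_prod G1 G2. Qed.

End Sum.

(** A disjoint union collects one distinguishing action for each inequivalent pair. *)
Lemma exists_separating (s : seq (seq bool * seq bool)) :
  exists (T : finType) (a : bool -> T -> T), good a /\
    forall p, p \in s -> ~ eqw p.1 p.2 -> exists t, act a t p.1 != act a t p.2.
Proof.
elim: s => [|[u v] s [T [a [aG aS]]]].
  by exists void, (fun _ t => t); split=> // w [].
have [uv|/existsNP[T' /existsNP[a' /existsNP[t' nuv]]]] := pselect (eqw u v).
  exists T, a; split=> // p; rewrite inE => /predU1P[->|/aS //] /=.
  by move/(_ uv).
have [aG' /eqP tn] := (not_implyP _ _).1 nuv.
exists (T + T')%type, (sum_act a a'); split; first exact: good_sum.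
move=> p; rewrite inE => /predU1P[->|ps] np; first by exists (inr t'); rewrite !act_sum.
by have [t tp] := aS p ps np; exists (inl t); rewrite !act_sum.
Qed.

Section Regular.
Variables (T : finType) (a : bool -> T -> T).
Hypothesis aG : good a.

Let letter_inj (b : bool) : injective (a b).
Proof. exact: act_inj aG [:: b]. Qed.

Definition regular_act (b : bool) (s : {perm T}) : {perm T} :=
  (s * perm (@letter_inj b))%g.

Lemma act_regular s w t : act regular_act s w t = act a (s t) w.
Proof. by elim: w s => [|b w IHw] s //=; rewrite IHw permM permE. Qed.

Lemma good_regular : good regular_act.
Proof. by move=> w s; apply/permP => t; rewrite act_regular aG. Qed.

End Regular.

(** The permutations of a separating set are acted on by right multiplication: agreement at one
    permutation forces agreement at every point of that set. *)
Lemma exists_free (s : seq (seq bool * seq bool)) :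
  exists (U : finType) (a : bool -> U -> U), [/\ good a, (0 < #|U|)%N &
    forall p u, p \in s -> act a u p.1 = act a u p.2 -> eqw p.1 p.2].
Proof.
have [T [a [aG aS]]] := exists_separating s.
exists {perm T}, (regular_act aG); split; first exact: good_regular.
  by apply/card_gt0P; exists 1%g.
move=> p u ps /permP pu; apply: contrapT => /(aS p ps)[t /eqP[]].
by have := pu (u^-1%g t); rewrite !act_regular permKV.
Qed.

(** * The group *)

Definition eqwb (u v : seq bool) : bool := `[< eqw u v >].

Lemma eqwb_equiv : equiv_class_of eqwb.
Proof.
split=> [u|u v|v u w /asboolP uv /asboolP vw]; first exact/asboolP.
- by apply/asbool_equiv_eq; split=> uv T a t aG; rewrite (uv T a t aG).
- by apply/asboolP => T a t aG; rewrite (uv T a t aG) (vw T a t aG).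
Qed.

Canonical eqwb_equivRel := EquivRelPack eqwb_equiv.

Definition Gam : Type := {eq_quot eqwb}%qT.
HB.instance Definition _ := Choice.on Gam.
HB.instance Definition _ := EqQuotient.on Gam.

Definition cls (u : seq bool) : Gam := (\pi u)%qT.
Definition rep (x : Gam) : seq bool := repr x.

Lemma repK : cancel rep cls.
Proof. exact: reprK. Qed.

Lemma clsP u v : cls u = cls v <-> eqw u v.
Proof. by split=> [/eqmodP/asboolP|uv]; last apply/eqmodP/asboolP. Qed.

Lemma rep_cls u : eqw (rep (cls u)) u.
Proof. by apply/clsP; rewrite repK. Qed.

Lemma eqw_cat u u' v v' : eqw u u' -> eqw v v' -> eqw (u ++ v) (u' ++ v').
Proof. by move=> uu vv T a t aG; rewrite !act_cat (uu T a t aG) (vv T a _ aG). Qed.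

Definition mulG (x y : Gam) : Gam := cls (rep x ++ rep y).
Definition invG (x : Gam) : Gam := cls (winv (rep x)).

Lemma mulG_cls u v : mulG (cls u) (cls v) = cls (u ++ v).
Proof. by apply/clsP/eqw_cat; exact: rep_cls. Qed.

Lemma mulGA : associative mulG.
Proof.
move=> x y z; rewrite -[x]repK -[y]repK -[z]repK.
by rewrite !mulG_cls catA.
Qed.

Lemma mul1G : left_id (cls [::]) mulG.
Proof. by move=> x; rewrite -[x]repK mulG_cls. Qed.

Lemma mulG1 : right_id (cls [::]) mulG.
Proof. by move=> x; rewrite -[x]repK mulG_cls cats0. Qed.

Lemma cls_wexp u : cls (wpow u (wexp u)) = cls [::].
Proof. by apply/clsP => T a t aG; rewrite aG. Qed.

Lemma mulVG : left_inverse (cls [::]) invG mulG.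
Proof. by move=> x; rewrite /invG -{2}[x]repK mulG_cls winv_cat cls_wexp. Qed.

Lemma mulGV : right_inverse (cls [::]) invG mulG.
Proof. by move=> x; rewrite /invG -{1}[x]repK mulG_cls cat_winv cls_wexp. Qed.

HB.instance Definition _ := isGroup.Build Gam mulGA mul1G mulG1 mulVG mulGV.

Lemma cls_cat u v : cls (u ++ v) = (cls u * cls v)%g.
Proof. by rewrite -mulG_cls. Qed.

Lemma cls_wpow u n : cls (wpow u n) = (cls u ^+ n)%g.
Proof. by elim: n => [|n IHn] //; rewrite wpowS cls_cat IHn expgS. Qed.

Lemma torsion_Gam : torsion_group Gam.
Proof.
move=> x; exists (wexp (rep x)); rewrite wexp_gt0; split=> //.
by rewrite -{1}[x]repK -cls_wpow cls_wexp.
Qed.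

Lemma fg_Gam : finitely_generated Gam.
Proof.
exists [:: cls [:: false]; cls [:: true]] => x.
exists [seq cls [:: b] | b <- rep x]; split.
  by apply/allP => _ /mapP[[] _ ->]; rewrite !inE eqxx ?orbT.
rewrite -{1}[x]repK; elim: (rep x) => [|b w IHw]; first by rewrite big_nil.
by rewrite /= big_cons -IHw -cls_cat.
Qed.

(** * Forests of Schreier edges *)

(* Independence of the boundaries gives a nonzero maximal minor of the incidence
   matrix, and a nonzero term of its expansion is the required assignment. *)
Lemma injective_endpoint (E V : finType) (src tgt : E -> V) (D : {set E}) :
  (forall z : E -> 'F_2, (forall e, e \notin D -> z e = 0) ->
     (forall v, \sum_e z e * ((tgt e == v)%:R - (src e == v)%:R) = 0) ->
     forall e, z e = 0) ->
  exists sg : E -> V, {in D &, injective sg} /\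
    {in D, forall e, sg e = src e \/ sg e = tgt e}.
Proof.
move=> indep; have [->|[e0 e0D]] := set_0Vmem D.
  by exists src; split=> [e e'|e]; rewrite inE.
pose A : 'M['F_2]_(#|D|, #|V|) :=
  \matrix_(i, j) ((tgt (enum_val i) == enum_val j)%:R -
                  (src (enum_val i) == enum_val j)%:R).
have Afree : row_free A^T^T.
  rewrite trmxK -kermx_eq0; apply/eqP/row_matrixP => i; rewrite row0.
  set r := row i _; have rA : r *m A = 0 by rewrite -row_mul mulmx_ker row0.
  pose z e := if e \in D then r 0 (enum_rank_in e0D e) else 0.
  have z0 : forall e, z e = 0.
    apply: indep => [e /negPf eD|v]; first by rewrite /z eD.
    have /rowP/(_ (enum_rank v)) := rA; rewrite !mxE => rAv; apply: etrans rAv.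
    rewrite [LHS](bigID (mem D)) /= addrC big1 ?add0r => [|e /negPf eD]; last first.
      by rewrite /z eD mul0r.
    rewrite big_enum_val /=; apply: eq_bigr => j _.
    by rewrite /z enum_valP enum_valK_in [A _ _]mxE enum_rankK.
  apply/rowP => j; have := z0 (enum_val j).
  by rewrite /z enum_valP enum_valK_in => ->; rewrite mxE.
have Afull : row_full A^T by rewrite /row_full -mxrank_tr.
have := fullrowsub_unit Afull; set f := fullrankfun Afull.
rewrite unitmxE unitfE /determinant => detA.
have [s sP] : exists s : 'S_#|D|, \prod_i (rowsub f A^T) i (s i) != 0.
  apply: contrapT => /forallNP s0; case/eqP: detA; apply: big1 => s _.
  by have /negP := s0 s; rewrite negbK => /eqP ->; rewrite mulr0.
have sgP i : A (s i) (f i) != 0.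
  by have /prodf_neq0/(_ i isT) := sP; rewrite !mxE.
exists (fun e => enum_val (f (s^-1%g (enum_rank_in e0D e)))); split.
  move=> e e' eD e'D /enum_val_inj/fullrankfun_inj/perm_inj.
  by move/(can_in_inj (enum_rankK_in e0D)); apply.
move=> e eD; set i := s^-1%g _; have := sgP i.
rewrite !mxE /i permKV enum_rankK_in // -/i.
case: (tgt e =P _) => [->|_]; first by right.
by case: (src e =P _) => [->|_]; [left | rewrite subrr eqxx].
Qed.

(* [K] is a maximal set of coordinates independent in the dual sense: no nonzero
   functional supported on [K] kills all the vectors [f c]. *)
Lemma exists_coordinate_basis (C I : finType) (W : {set C}) (f : C -> I -> 'F_2) :
  exists K : {set I},
    (forall z : I -> 'F_2, (forall e, e \notin K -> z e = 0) ->
       {in W, forall c, \sum_e z e * f c e = 0} -> forall e, z e = 0) /\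
    {in W &, forall c c', {in K, f c =1 f c'} -> f c =1 f c'}.
Proof.
pose indep (K : {set I}) := `[< forall z : I -> 'F_2,
  (forall e, e \notin K -> z e = 0) ->
  {in W, forall c, \sum_e z e * f c e = 0} -> forall e, z e = 0 >].
have [|K /maxsetP[/asboolP Kind Kmax]] := @ex_maxset _ indep.
  by exists finset.set0; apply/asboolP => z z0 _ e; rewrite z0 ?inE.
exists K; split=> // c c' cW cW' ccK e.
have [/ccK //|eK] := boolP (e \in K).
(* Adjoining [e] to the maximal [K] creates a relation with nonzero coefficient at [e], which
   expresses [f c e] through the coordinates in [K]. *)
have /asboolPn/existsNP[z /not_implyP[zK /not_implyP[zW /existsNP[e1 ze1]]]] :
    ~~ indep (e |: K).
  apply/negP => /Kmax/(_ (finset.subsetUr _ _)) eKK.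
  by move: eK; rewrite -eKK !inE eqxx.
have ze : z e != 0.
  apply/eqP => ze; apply: ze1; apply: Kind => // e' e'K.
  by have [->//|ne] := eqVneq e' e; apply: zK; rewrite !inE negb_or ne.
apply: (mulfI ze).
have zfE d : d \in W -> z e * f d e = - \sum_(e' in K) z e' * f d e'.
  move=> dW; have := zW d dW; rewrite (bigD1 e) //= => /eqP.
  rewrite addr_eq0 => /eqP ->; congr (- _).
  rewrite [LHS](bigID (mem K)) /= [X in _ + X]big1 ?addr0 => [|i].
    apply: eq_bigl => i; rewrite andb_idl //; apply: contraTN => /eqP ->; exact: eK.
  by case/andP=> ie iK; rewrite zK ?mul0r // !inE negb_or ie.
by rewrite !zfE //; congr (- _); apply: eq_bigr => i iK; rewrite ccK.
Qed.

(** The double cover [twist a c] is itself a finite good action, so equivalent words agree there,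
    and its second component records the cocycle sum. *)
Lemma cext_eqw (T : finType) (a : bool -> T -> T) c t u v :
  good a -> goodc a c -> eqw u v -> cext a c t u = cext a c t v.
Proof.
move=> aG cG /(_ _ _ (t, 0) (good_twist aG cG)); rewrite !act_twist /=.
by move/(congr1 snd); rewrite /= !add0r.
Qed.

Section Stage.
Variables (T : finType) (aT : bool -> T -> T) (t0 : T) (x : T -> seq bool).
Hypotheses (aTG : good aT) (xE : forall t, act aT t0 (x t) = t).
Variables (U : finType) (aU : bool -> U -> U).
Hypothesis aUG : good aU.

(** Schreier's generator of the stabiliser of [t0] attached to the edge [s], for the transversal
    [x]. *)
Definition schreier (s : T * bool) : seq bool :=
  x s.1 ++ s.2 :: winv (x (aT s.2 s.1)).

Definition schreier_cls (s : T * bool) : Gam := cls (schreier s).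

Lemma act_schreier s : act aT t0 (schreier s) = t0.
Proof.
by rewrite /schreier act_cat xE /= -{1}(xE (aT s.2 s.1)) act_winvK.
Qed.

Let aQ := prod_act aU aT.
Let aQG : good aQ. Proof. exact: good_prod. Qed.

Definition schreier_cext (c : {ffun (U * T) * bool -> 'F_2})
  (e : U * (T * bool)) : 'F_2 := cext aQ c (e.1, t0) (schreier e.2).

Lemma schreier_cext_inj (c c' : {ffun (U * T) * bool -> 'F_2}) :
  goodc aQ c -> goodc aQ c' -> schreier_cext c =1 schreier_cext c' ->
  (forall u t, cext aQ c (u, t0) (x t) = cext aQ c' (u, t0) (x t)) -> c = c'.
Proof.
move=> cG cG' ccS ccx; apply/ffunP => -[[u' t] b].
(* With this [u] the path [x t] from [(u, t0)] ends at [(u', t)], so the edge value is a difference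
   of two path sums. *)
pose u := act aU u' (winv (x t)).
have uE (d : {ffun (U * T) * bool -> 'F_2}) :
    d ((u', t), b) =
    cext aQ d (u, t0) (x t ++ [:: b]) - cext aQ d (u, t0) (x t).
  rewrite cext_cat act_prod /= xE /u act_winvVK //.
  by rewrite addr0 addrC addKr.
(* Up to a relator, [x t] followed by [b] is a Schreier generator followed by a transversal word. *)
have bE d : goodc aQ d -> cext aQ d (u, t0) (x t ++ [:: b]) =
    schreier_cext d (u, (t, b)) +
    cext aQ d (act aU u (schreier (t, b)), t0) (x (aT b t)).
  move=> dG.
  have -> : schreier_cext d (u, (t, b)) +
      cext aQ d (act aU u (schreier (t, b)), t0) (x (aT b t)) =
      cext aQ d (u, t0) (schreier (t, b) ++ x (aT b t)).
    by rewrite cext_cat act_prod /= act_schreier.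
  rewrite /schreier /= -catA cat_cons winv_cat -(cat1s b (wpow _ _)) catA [RHS]cext_cat.
  by rewrite dG addr0.
by rewrite !uE !bE // ccS !ccx.
Qed.

(** A cocycle is determined by its values on [K] and along the transversal, so the cocycles have
    dimension at most [#|K| + #|U| * #|T|]; it is also at least [3/2 * #|U| * #|T|]. *)
Lemma exists_free_edges : exists K : {set U * (T * bool)},
  (forall z : U * (T * bool) -> 'F_2, (forall e, e \notin K -> z e = 0) ->
     (forall c, goodc aQ c -> \sum_e z e * schreier_cext c e = 0) ->
     forall e, z e = 0) /\
  (#|U| * #|T| <= 2 * #|K|)%N.
Proof.
have [K [Kind Kdet]] := exists_coordinate_basis (cocycles aQ) schreier_cext.
exists K; split=> [z zK zc|].
  by apply: Kind => // c /cocyclesP; exact: zc.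
have [P [P2 cP]] := card_cocycles aQG.
pose h c : {ffun {e | e \in K} -> 'F_2} * {ffun U * T -> 'F_2} :=
  ([ffun e => schreier_cext c (val e)],
   [ffun p => cext aQ c (p.1, t0) (x p.2)]).
have hI : {in cocycles aQ &, injective h}.
  move=> c c' cW cW' [/ffunP eS /ffunP ex]; move/cocyclesP: (cW) => cG.
  move/cocyclesP: (cW') => cG'; apply: schreier_cext_inj => // [|u t].
    apply: Kdet => // e eK; have := eS (exist (fun e => e \in K) e eK).
    by rewrite !ffunE.
  by have := ex (u, t); rewrite !ffunE.
have : (#|cocycles aQ| <= 2 ^ #|K| * 2 ^ (#|U| * #|T|))%N.
  rewrite -(card_in_imset hI); apply: leq_trans (max_card _) _.
  rewrite card_prod !card_ffun card_prod card_Fp // card_sig.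
  by rewrite (eq_card (B := K)).
rewrite card_prod in P2 cP => cK.
have : (2 ^ (2 * (#|U| * #|T|)) <= 2 ^ (#|K| + #|U| * #|T| + P))%N.
  by apply: leq_trans cP _; rewrite !expnD leq_mul2r cK orbT.
have arith k M : (2 * P <= M)%N -> (2 * M <= k + M + P)%N -> (M <= 2 * k)%N by lia.
by rewrite leq_exp2l //; exact: arith.
Qed.

Section Forest.
Variable K : {set U * (T * bool)}.
Hypothesis K_ind : forall z : U * (T * bool) -> 'F_2,
  (forall e, e \notin K -> z e = 0) ->
  (forall c, goodc aQ c -> \sum_e z e * schreier_cext c e = 0) ->
  forall e, z e = 0.
Variables (B : seq Gam) (u : U).
Hypothesis u_free : {in B &, forall g h,
  act aU u (rep g) = act aU u (rep h) -> g = h}.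

Let V : finType := seq_sub B.
Let E : finType := (V * (T * bool))%type.

Definition edge_src (e : E) : V := e.1.
(** The default [e.1] occurs only when the target leaves [B]; [edges] excludes that case. *)
Definition edge_tgt (e : E) : V := insubd e.1 (val e.1 * schreier_cls e.2)%g.
Definition edges : {set E} := finset (fun e : E =>
  ((val e.1 * schreier_cls e.2)%g \in B) && ((act aU u (rep (val e.1)), e.2) \in K)).

Lemma exists_orientation : exists sg : E -> V, {in edges &, injective sg} /\
  {in edges, forall e, sg e = edge_src e \/ sg e = edge_tgt e}.
Proof.
apply: injective_endpoint => z zD zbd.
(* [tau g] is the base point of the left coset of the stabiliser through [g]:
   along that coset, [h] below is a potential for the cocycle [c] *)
pose tau (g : Gam) := act aT t0 (winv (rep g)).
have tauE g : act aT (tau g) (rep g) = t0 by exact: act_winvVK.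
have rep_mul (g : Gam) s : eqw (rep (g * schreier_cls s)%g) (rep g ++ schreier s).
  by apply/clsP; rewrite repK cls_cat repK.
have tau_tgt g s : tau (g * schreier_cls s)%g = tau g.
  apply: (act_inj aTG (w := rep (g * schreier_cls s)%g)).
  by rewrite tauE (rep_mul g s _ _ _ aTG) act_cat tauE act_schreier.
(* Summation by parts: on a drawn edge the cocycle is the difference of the potential [h] at the
   endpoints, so it pairs to zero with a chain without boundary. *)
have zK c : goodc aQ c ->
    \sum_e z e * schreier_cext c (act aU u (rep (val e.1)), e.2) = 0.
  move=> cG; pose h (v : V) := cext aQ c (u, tau (val v)) (rep (val v)).
  transitivity (\sum_v h v *
      \sum_e z e * ((edge_tgt e == v)%:R - (edge_src e == v)%:R)); last first.
    by apply: big1 => v _; rewrite zbd mulr0.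
  under [RHS]eq_bigr do rewrite mulr_sumr.
  rewrite exchange_big /=; apply: eq_bigr => e _.
  have [eD|/zD ->] := boolP (e \in edges); last first.
    by rewrite mul0r big1 // => v _; rewrite mul0r mulr0.
  under eq_bigr do rewrite mulrCA mulrBr.
  rewrite -mulr_sumr sumrB; congr (_ * _).
  have sumE (w : V) : \sum_v h v * (w == v)%:R = h w.
    rewrite (bigD1 w) //= eqxx mulr1 big1 ?addr0 // => v vw.
    by rewrite eq_sym (negPf vw) mulr0.
  rewrite !sumE; move: eD; rewrite inE => /andP[eB _].
  rewrite /h /edge_tgt /edge_src val_insubd eB tau_tgt.
  rewrite (cext_eqw _ aQG cG (rep_mul _ _)) cext_cat act_prod /= tauE.
  by rewrite addrC addKr.
(* The pushforward of [z] along the orbit map of [u] is supported on [K] and kills every cocycle, so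
   it vanishes; by [u_free] each nonempty fibre is a single vertex, hence [z] vanishes too. *)
pose z' (p : U * (T * bool)) : 'F_2 :=
  \sum_(v : V | act aU u (rep (val v)) == p.1) z (v, p.2).
have z'0 : forall p, z' p = 0.
  apply: K_ind => [p pK|c cG].
    apply: big1 => v /eqP vp; apply: zD; rewrite inE negb_and /= vp.
    by rewrite -surjective_pairing pK orbT.
  apply: etrans (zK c cG); rewrite /z'.
  under eq_bigr do rewrite mulr_suml.
  rewrite (exchange_big_dep xpredT) //=.
  pose F v u' s := z (v, s) * schreier_cext c (u', s).
  transitivity (\sum_v \sum_s F v (act aU u (rep (val v))) s); last first.
    by rewrite pair_bigA /=; apply: eq_bigr => -[v s].
  apply: eq_bigr => v _.
  transitivity (\sum_(u' | act aU u (rep (val v)) == u') \sum_s F v u' s).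
    by rewrite pair_big_dep /=; apply: eq_big => -[u' s]; rewrite ?andbT.
  by rewrite (big_pred1 (act aU u (rep (val v)))).
move=> [v s]; have := z'0 (act aU u (rep (val v)), s).
rewrite /z' (big_pred1 v) //= => v'; apply/eqP/eqP => [|-> //].
by move/(u_free (valP v') (valP v))/val_inj.
Qed.

End Forest.
End Stage.

(** * Averaging and passing to the limit *)

(** The identity is required on the finite window [B] only, while the sum bounds hold everywhere; a
    limit over growing windows then gives an element of T_1. *)
Definition partial_T1 (B : seq Gam) (M : RR) (F1 F2 : Gam -> Gam -> RR)
    (f : Gam -> RR) : Prop :=
  [/\ forall g h, 0 <= F1 g h /\ 0 <= F2 g h,
      forall g r, uniq r -> \sum_(h <- r) F1 g h <= M,
      forall h r, uniq r -> \sum_(g <- r) F2 g h <= M &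
      {in B &, forall g h, F1 g h + F2 g h = f (g^-1 * h)%g}].

Lemma sum_card_fibers (E : finType) (V : eqType) (r : seq V) (h : E -> V) (D : {set E}) :
  uniq r -> (\sum_(y <- r) #|finset (fun e => (e \in D) && (h e == y))|)%N =
  #|finset (fun e => (e \in D) && (h e \in r))|.
Proof.
move=> Ur; under eq_bigr do rewrite -sum1dep_card big_mkcondr /=.
rewrite exchange_big /= -sum1dep_card big_mkcondr /=; apply: eq_bigr => e _.
rewrite -big_mkcond /= sum1_count (eq_count (a2 := pred1 (h e))) => [|y].
  by rewrite count_uniq_mem //; case: (_ \in _).
by rewrite /= eq_sym.
Qed.

Section RealStage.
Variables (T : finType) (aT : bool -> T -> T) (t0 : T) (x : T -> seq bool).
Hypotheses (aTG : good aT) (xE : forall t, act aT t0 (x t) = t).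
Variables (U : finType) (aU : bool -> U -> U).
Hypotheses (aUG : good aU) (U0 : (0 < #|U|)%N).
Variable B : seq Gam.
Hypothesis aU_free : forall u, {in B &, forall g h,
  act aU u (rep g) = act aU u (rep h) -> g = h}.

Let V : finType := seq_sub B.
Let E : finType := (V * (T * bool))%type.
Let scls := schreier_cls aT x.

Lemma exists_partial_T1 : exists F1 F2 f, [/\ partial_T1 B 1 F1 F2 f,
  forall g, 0 <= f g & #|T|%:R / 2 <= \sum_(g <- undup [seq scls s | s : T * bool]) f g].
Proof.
have [K [Kind cK]] := exists_free_edges aTG xE aUG.
have /choice[sg sgP] := fun u => exists_orientation aTG xE aUG Kind (@aU_free u).
pose D u := edges (aT) x aU K B u.
pose src (e : E) : V := edge_src e.
pose tgt (e : E) : V := edge_tgt aT x e.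
(* Edges charged to their source feed [F1], the others [F2]: injectivity of [sg u] leaves at most
   one of the former per source and one of the latter per target. *)
pose C1 u := finset (fun e : E => (e \in D u) && (sg u e == src e)).
pose C2 u := finset (fun e : E => (e \in D u) && (sg u e != src e)).
pose fib (C : {set E}) g h :=
  #|finset (fun e => (e \in C) && ((val (src e), val (tgt e)) == (g, h)))|.
pose avg (n : nat) : RR := n%:R / #|U|%:R.
have avg_ge0 n : 0 <= avg n by rewrite divr_ge0.
have avg_sum_le1 (I : Type) (r : seq I) (m : I -> U -> nat) :
    (forall u, \sum_(i <- r) m i u <= 1)%N -> \sum_(i <- r) avg (\sum_u m i u) <= 1.
  move=> m1; rewrite -mulr_suml -natr_sum exchange_big /=.
  rewrite ler_pdivrMr ?ltr0n // mul1r ler_nat -sum1_card.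
  exact: leq_sum.
exists (fun g h => avg (\sum_u fib (C1 u) g h)%N),
       (fun g h => avg (\sum_u fib (C2 u) g h)%N),
       (fun g => avg #|finset (fun k => (k \in K) && (scls k.2 == g))|).
split=> //; first split=> //.
- move=> g r Ur; apply: avg_sum_le1 => u.
  rewrite (eq_bigr (fun h => #|finset (fun e => (e \in
     finset (fun e => (e \in C1 u) && (val (src e) == g))) && (val (tgt e) == h))|)).
    rewrite sum_card_fibers //; apply/fintype.card_le1_eqP => e e'.
    rewrite !inE -!andbA => /and5P[b1 k1 /eqP s1 /eqP g1 _] /and5P[b2 k2 /eqP s2 /eqP g2 _].
    have [inj _] := sgP u; apply: inj; rewrite ?inE ?b1 ?b2 //.
    by rewrite s1 s2; apply: val_inj; rewrite g1 g2.
  by move=> h _; apply: eq_card => e; rewrite !inE xpair_eqE -!andbA.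
- move=> h r Ur; apply: avg_sum_le1 => u.
  rewrite (eq_bigr (fun g => #|finset (fun e => (e \in
     finset (fun e => (e \in C2 u) && (val (tgt e) == h))) && (val (src e) == g))|)).
    rewrite sum_card_fibers //; apply/fintype.card_le1_eqP => e e'.
    rewrite !inE -!andbA => /and5P[b1 k1 s1 /eqP g1 _] /and5P[b2 k2 s2 /eqP g2 _].
    have eD : e \in D u by rewrite inE b1 k1.
    have eD' : e' \in D u by rewrite inE b2 k2.
    have [inj sgE] := sgP u; apply: inj => //.
    have [/eqP|->] := sgE e eD; first by rewrite (negPf s1).
    have [/eqP|->] := sgE e' eD'; first by rewrite (negPf s2).
    by apply: val_inj; rewrite g1 g2.
  by move=> g _; apply: eq_card => e; rewrite !inE xpair_eqE -!andbA [(_ == g) && _]andbC.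
- move=> g h gB hB; rewrite -mulrDl -natrD -big_split /=; congr (_%:R / _).
  pose m v := #|finset (fun s => ((v, s) \in K) && (scls s == (g^-1 * h)%g))|.
  transitivity (\sum_u m (act aU u (rep g)))%N.
    apply: eq_bigr => u _.
    transitivity #|finset (fun e => (e \in D u) && ((val (src e), val (tgt e)) == (g, h)))|.
      rewrite /fib -cardsUI [X in (_ + X)%N]eq_card0 ?addn0.
        apply: eq_card => e; rewrite !inE.
        by case: (sg u e == src e); rewrite ?andbT ?andbF ?orbF ?orbF.
      move=> e; rewrite !inE.
      by case: (sg u e == src e); rewrite ?andbT ?andbF ?orbF ?orbF.
    pose inc s : E := (SeqSub gB, s).
    have incI : injective inc by move=> s s' [].
    rewrite /m -(card_imset _ incI); apply: eq_card => -[v s].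
    rewrite !inE /= xpair_eqE.
    apply/idP/imsetP => [|[s' + [-> ->]]].
      case/andP=> /andP[tB vK] /andP[/eqP vg]; rewrite val_insubd tB => /eqP vs.
      exists s; last by congr (_, _); apply: val_inj.
      by rewrite inE -vg vK /= -vs mulKg.
    rewrite inE => /andP[-> /eqP ss] /=; rewrite eqxx val_insubd.
    by rewrite -/scls ss mulVKg hB eqxx.
  (* Since [rep g] permutes [U], averaging removes the dependence on [g]; only [g^-1 * h]
     remains. *)
  transitivity (\sum_v m v)%N.
    by rewrite [RHS](reindex _ (onW_bij _ (act_bij aUG (rep g)))).
  rewrite /m; under eq_bigr do rewrite -sum1dep_card.
  by rewrite pair_big_dep /= -sum1dep_card; apply: eq_bigl => -[v s].
(* Every label from [K] is in the list, so the total is [#|K| / #|U|]. *)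
- rewrite -mulr_suml -natr_sum sum_card_fibers ?undup_uniq //.
  rewrite (@eq_card _ _ K) => [|k]; last first.
    rewrite inE andb_idr // => _; rewrite mem_undup; exact: fintype.image_f.
  rewrite ler_pdivlMr ?ltr0n // mulrAC ler_pdivrMr // -!natrM ler_nat.
  by rewrite mulnC [(_ * 2)%N]mulnC.
Qed.

End RealStage.

Local Open Scope classical_set_scope.

(** * Generalized limits along an ultrafilter *)

Definition bounded_seq (R : realType) (u : nat -> R) : Prop :=
  exists M, forall n, `|u n| <= M.

Lemma bounded_seqD (R : realType) (u v : nat -> R) :
  bounded_seq u -> bounded_seq v -> bounded_seq (fun n => u n + v n).
Proof.
move=> [M uM] [M' vM]; exists (M + M') => n.
by apply: le_trans (ler_normD _ _) _; exact: lerD.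
Qed.

Lemma bounded_seqN (R : realType) (u : nat -> R) :
  bounded_seq u -> bounded_seq (fun n => - u n).
Proof. by move=> [M uM]; exists M => n; rewrite normrN. Qed.

Lemma bounded_seq_sum (R : realType) (I : Type) (r : seq I) (u : I -> nat -> R) :
  (forall i, bounded_seq (u i)) -> bounded_seq (fun n => \sum_(i <- r) u i n).
Proof.
move=> uB; elim: r => [|i r IHr].
  by exists 0 => n; rewrite big_nil normr0.
have [M MP] := bounded_seqD (uB i) IHr.
by exists M => n; rewrite big_cons; exact: MP.
Qed.

(** By compactness of [[-M, M]] the image filter has a cluster point, and an ultrafilter converges
    to any of its cluster points. *)
Lemma ultra_cvg_bounded (R : realType) (F : set_system nat) (u : nat -> R) :
  UltraFilter F -> bounded_seq u -> exists l : R, u @ F --> l.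
Proof.
move=> FU [M uM].
have uF : (u @ F) `[- M, M].
  by apply: (@filterS _ F _ setT) filterT => n _; rewrite /= in_itv /= -ler_norml.
have [p [_ pcl]] := @segment_compact R (- M) M (u @ F) _ uF.
exists p => A pA; have [//|uA] := in_ultra_setVsetC (u @^-1` A) FU.
by have [r [nr /nr]] := pcl (~` A) A uA pA.
Qed.

(** [L] is the limit along an ultrafilter refining [\oo]; on unbounded sequences its value is
    arbitrary. *)
Lemma exists_generalized_limit (R : realType) : exists L : (nat -> R) -> R,
  [/\ forall u v, bounded_seq u -> bounded_seq v ->
        L (fun n => u n + v n) = L u + L v,
      forall u c, bounded_seq u -> (\forall n \near \oo, u n <= c) -> L u <= c &
      forall u c, bounded_seq u -> (\forall n \near \oo, c <= u n) -> c <= L u].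
Proof.
have [F [FU ooF]] := @ultraFilterLemma nat \oo _.
have /choice[L LP] : forall u : nat -> R, exists l : R, bounded_seq u -> u @ F --> l.
  move=> u; have [/(ultra_cvg_bounded FU)[l ul]|nu] := pselect (bounded_seq u).
    by exists l.
  by exists 0 => /nu.
exists L; split=> [u v uB vB|u c uB uc|u c uB uc].
- have uvL := LP _ (bounded_seqD uB vB).
  apply: (cvg_unique _ uvL); first exact: Rhausdorff.
  exact: cvgD (LP _ uB) (LP _ vB).
- by apply: (cvgr_to_le (LP _ uB)); exact: ooF.
- by apply: (cvgr_to_ge (LP _ uB)); exact: ooF.
Qed.

Section GeneralizedLimit.
Variables (R : realType) (L : (nat -> R) -> R).
Hypothesis LD : forall u v, bounded_seq u -> bounded_seq v ->
  L (fun n => u n + v n) = L u + L v.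
Hypothesis Lle : forall u c, bounded_seq u ->
  (\forall n \near \oo, u n <= c) -> L u <= c.
Hypothesis Lge : forall u c, bounded_seq u ->
  (\forall n \near \oo, c <= u n) -> c <= L u.

Lemma glim_cst (c : R) : L (fun=> c) = c.
Proof.
have cB : bounded_seq (fun=> c) by exists `|c|.
by apply/le_anti; rewrite Lle ?Lge //; exact: nearW.
Qed.

Lemma glim_near_eq u v : bounded_seq u -> bounded_seq v ->
  (\forall n \near \oo, u n = v n) -> L u = L v.
Proof.
move=> uB vB uv; have dB := bounded_seqD uB (bounded_seqN vB).
have -> : u = (fun n => v n + (u n - v n)).
  by apply/funext => n; rewrite addrC subrK.
rewrite LD // (_ : L (fun n => u n - v n) = 0) ?addr0 //.
by apply/le_anti/andP; split; [apply: Lle | apply: Lge] => //;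
  apply: filterS uv => n ->; rewrite subrr.
Qed.

Lemma glim_sum (I : Type) (r : seq I) (u : I -> nat -> R) :
  (forall i, bounded_seq (u i)) ->
  L (fun n => \sum_(i <- r) u i n) = \sum_(i <- r) L (u i).
Proof.
move=> uB; elim: r => [|i r IHr].
  rewrite big_nil -[RHS](glim_cst 0); congr L; apply/funext => n.
  by rewrite big_nil.
rewrite big_cons -IHr -LD //; last exact: bounded_seq_sum.
by congr L; apply/funext => n; rewrite big_cons.
Qed.

End GeneralizedLimit.

(** * Exhaustion of the group by finite windows, and the limit function *)

Definition initial_Gam (n : nat) : seq Gam :=
  [seq cls (odflt [::] (unpickle i)) | i <- iota 0 n].

Lemma near_initial_Gam (g : Gam) : \forall n \near \oo, g \in initial_Gam n.
Proof.
exists (pickle (rep g)).+1 => // n /= ng; apply/mapP; exists (pickle (rep g)).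
  by rewrite mem_iota add0n.
by rewrite pickleK /= repK.
Qed.

Lemma near_sub_initial_Gam (r : seq Gam) : \forall n \near \oo, {subset r <= initial_Gam n}.
Proof.
elim: r => [|g r IHr]; first by apply: nearW => n.
apply: filterS2 (near_initial_Gam g) IHr => n gn rn h.
by rewrite inE => /predU1P[->|/rn].
Qed.

Lemma partial_T1_limit (M : RR) (F1 F2 : nat -> Gam -> Gam -> RR) (f : nat -> Gam -> RR) :
  (forall n, partial_T1 (initial_Gam n) M (F1 n) (F2 n) (f n)) ->
  exists Phi1 Phi2 phi, (forall B, partial_T1 B M Phi1 Phi2 phi) /\
    forall r c, (\forall n \near \oo, c <= \sum_(g <- r) f n g) ->
      c <= \sum_(g <- r) phi g.
Proof.
move=> FP; have [L [LD Lle Lge]] := exists_generalized_limit RR.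
have B1 g h : bounded_seq (fun n => F1 n g h).
  exists M => n; have [F0 F1M _ _] := FP n.
  by rewrite ger0_norm ?(F0 g h).1 //; have := F1M g [:: h] isT; rewrite big_seq1.
have B2 g h : bounded_seq (fun n => F2 n g h).
  exists M => n; have [F0 _ F2M _] := FP n.
  by rewrite ger0_norm ?(F0 g h).2 //; have := F2M h [:: g] isT; rewrite big_seq1.
(* The values [f n g] are not controlled while [1] or [g] is outside the window; [v g] is bounded
   for all [n] and eventually equal to [f n g]. *)
pose v g n := F1 n 1%g g + F2 n 1%g g.
have vB g : bounded_seq (v g) by exact: bounded_seqD.
exists (fun g h => L (fun n => F1 n g h)), (fun g h => L (fun n => F2 n g h)),
  (fun g => L (v g)); split=> [B|r c rc]; first split.
- by move=> g h; split; apply: Lge => //; apply: nearW => n; have [F0 _ _ _] := FP n;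
    have [] := F0 g h.
- move=> g r Ur; rewrite -(glim_sum LD Lle Lge) //; apply: Lle; first exact: bounded_seq_sum.
  by apply: nearW => n; have [_ F1M _ _] := FP n; exact: F1M.
- move=> h r Ur; rewrite -(glim_sum LD Lle Lge) //; apply: Lle; first exact: bounded_seq_sum.
  by apply: nearW => n; have [_ _ F2M _] := FP n; exact: F2M.
- move=> g h _ _; rewrite -LD //; apply: (glim_near_eq LD Lle Lge) => //.
    exact: bounded_seqD.
  apply: filterS (near_sub_initial_Gam [:: g; h; 1%g; (g^-1 * h)%g]) => n sub.
  have [_ _ _ FE] := FP n.
  rewrite /v !FE ?sub ?inE ?eqxx ?orbT //.
  by rewrite invg1 mul1g.
- rewrite -(glim_sum LD Lle Lge) //; apply: Lge; first exact: bounded_seq_sum.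
  apply: filterS2 rc (near_sub_initial_Gam (1%g :: r)) => n crn sub.
  apply: le_trans crn _; rewrite le_eqVlt; apply/orP; left; apply/eqP.
  apply: eq_big_seq => g gr; have [_ _ _ FE] := FP n.
  by rewrite /v FE ?invg1 ?mul1g //; apply: sub; rewrite inE ?eqxx ?gr ?orbT.
Qed.

(** The list [A] of Schreier generators depends on the orbit alone, and [U] is chosen afterwards to
    be free on [B]. As [A] stays fixed while [B] grows, the mass on it survives the limit. *)
Lemma partial_T1_stage (k : nat) : exists A : seq Gam,
  [/\ uniq A, (size A <= 2 * 2 ^ k)%N & forall B, exists F1 F2 f,
    [/\ partial_T1 B 1 F1 F2 f, forall g, 0 <= f g &
        (2 ^ k)%:R / 2 <= \sum_(g <- A) f g]].
Proof.
have [T [a [t0 [aG aT cT]]]] := exists_large_orbit k.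
have [x xE] := choice aT.
exists (undup [seq schreier_cls a x s | s : T * bool]).
rewrite undup_uniq; split=> // [|B].
  apply: leq_trans (size_undup _) _.
  by rewrite size_map -cardE card_prod card_bool cT mulnC.
have [U [aU [aUG U0 Ufree]]] :=
  exists_free [seq (rep g, rep h) | g <- B, h <- B].
have free u : {in B &, forall g h, act aU u (rep g) = act aU u (rep h) -> g = h}.
  move=> g h gB hB /(Ufree (rep g, rep h)) gh.
  rewrite -[g]repK -[h]repK; apply/clsP/gh.
  exact: (allpairs_f (fun g h => (rep g, rep h))).
have [F1 [F2 [f [FP f0 fA]]]] := exists_partial_T1 aG xE aUG U0 free.
by exists F1, F2, f; split=> //; rewrite -cT.
Qed.

Lemma partial_T1_sum (I : Type) (r : seq I) (w : I -> RR) B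
    (F1 F2 : I -> Gam -> Gam -> RR) (f : I -> Gam -> RR) :
  (forall i, 0 <= w i) -> (forall i, partial_T1 B 1 (F1 i) (F2 i) (f i)) ->
  partial_T1 B (\sum_(i <- r) w i) (fun g h => \sum_(i <- r) w i * F1 i g h)
    (fun g h => \sum_(i <- r) w i * F2 i g h) (fun g => \sum_(i <- r) w i * f i g).
Proof.
move=> w0 FP; split.
- move=> g h; split; apply: sumr_ge0 => i _; apply: mulr_ge0 => //;
    by have [F0 _ _ _] := FP i; have [] := F0 g h.
- move=> g s Us; rewrite exchange_big /=; apply: ler_sum => i _.
  rewrite -mulr_sumr ler_piMr //; by have [_ F1M _ _] := FP i; exact: F1M.
- move=> h s Us; rewrite exchange_big /=; apply: ler_sum => i _.
  rewrite -mulr_sumr ler_piMr //; by have [_ _ F2M _] := FP i; exact: F2M.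
- move=> g h gB hB; rewrite -big_split /=; apply: eq_bigr => i _.
  by rewrite -mulrDr; have [_ _ _ ->] := FP i.
Qed.

Lemma sum_geometric_half (n : nat) : \sum_(j < n) (2^-1 : RR) ^+ j <= 2.
Proof.
suff -> : \sum_(j < n) (2^-1 : RR) ^+ j = 2 - 2 * 2^-1 ^+ n.
  by rewrite gerBl mulr_ge0 // exprn_ge0 // invr_ge0.
elim: n => [|n IHn]; first by rewrite big_ord0 expr0 mulr1 subrr.
by rewrite big_ord_recr /= IHn exprS; field.
Qed.

Lemma partial_T1_le (B : seq Gam) (M M' : RR) F1 F2 f :
  M <= M' -> partial_T1 B M F1 F2 f -> partial_T1 B M' F1 F2 f.
Proof.
move=> MM [F0 F1M F2M FE]; split=> // g r Ur.
  exact: le_trans (F1M _ _ Ur) MM.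
exact: le_trans (F2M _ _ Ur) MM.
Qed.

Lemma exists_spread_T1 : exists Phi1 Phi2 phi, exists A : nat -> seq Gam,
  (forall B, partial_T1 B 2 Phi1 Phi2 phi) /\
  forall j, [/\ uniq (A j), (size (A j) <= 2 * 2 ^ (j * j))%N &
    2^-1 ^+ j * ((2 ^ (j * j))%:R / 2) <= \sum_(g <- A j) phi g].
Proof.
have /choice[A AP] := fun j => partial_T1_stage (j * j).
have /choice[X XP] : forall p : nat * nat,
    exists F : (Gam -> Gam -> RR) * (Gam -> Gam -> RR) * (Gam -> RR),
    [/\ partial_T1 (initial_Gam p.1) 1 F.1.1 F.1.2 F.2, forall g, 0 <= F.2 g &
        (2 ^ (p.2 * p.2))%:R / 2 <= \sum_(g <- A p.2) F.2 g].
  move=> [n j]; have [_ _ /(_ (initial_Gam n))[F1 [F2 [f FP]]]] := AP j.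
  by exists (F1, F2, f).
have w0 (j : nat) : 0 <= (2^-1 : RR) ^+ j by rewrite exprn_ge0 // invr_ge0.
have [Phi1 [Phi2 [phi [PhiP phiA]]]] := @partial_T1_limit 2
  (fun n g h => \sum_(j < n) 2^-1 ^+ j * (X (n, val j)).1.1 g h)
  (fun n g h => \sum_(j < n) 2^-1 ^+ j * (X (n, val j)).1.2 g h)
  (fun n g => \sum_(j < n) 2^-1 ^+ j * (X (n, val j)).2 g)
  (fun n => partial_T1_le (sum_geometric_half n)
     (partial_T1_sum (index_enum 'I_n) (fun i => w0 i)
        (fun j => let: And3 FP _ _ := XP (n, val j) in FP))).
exists Phi1, Phi2, phi, A; split=> // j; have [UA sA _] := AP j; split=> //.
(* For [n > j] the [j]-th summand alone gives the bound, the others being nonnegative. *)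
apply: phiA; exists j.+1 => // n /= jn.
apply: le_trans (_ : \sum_(g <- A j) 2^-1 ^+ j * (X (n, j)).2 g <= _).
  by rewrite -mulr_sumr; apply: ler_wpM2l => //; have [] := XP (n, j).
apply: ler_sum => g _; rewrite (bigD1 (Ordinal jn)) //= lerDl.
by apply: sumr_ge0 => i _; rewrite mulr_ge0 //; have [] := XP (n, val i).
Qed.

Lemma cmod_real (r : RR) : cmod (Complex r 0) = `|r|.
Proof. by rewrite /cmod /= expr0n /= addr0 sqrtr_sqr. Qed.

Lemma T1_of_partial (Phi1 Phi2 : Gam -> Gam -> RR) (phi : Gam -> RR) (M : RR) :
  (forall B, partial_T1 B M Phi1 Phi2 phi) -> T1 (fun g => Complex (phi g) 0).
Proof.
move=> P; exists (fun g h => Complex (Phi1 g h) 0), (fun g h => Complex (Phi2 g h) 0).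
have [P0 P1 P2 _] := P [::]; split=> [g h|].
  have [_ _ _ PE] := P [:: g; h].
  by rewrite -PE ?inE ?eqxx ?orbT //; congr Complex; rewrite addr0.
split; exists M => g s Us.
  by under eq_bigr do rewrite cmod_real ger0_norm ?(P0 _ _).1 //; exact: P1.
by under eq_bigr do rewrite cmod_real ger0_norm ?(P0 _ _).2 //; exact: P2.
Qed.

(** * Divergence of the [p]-th power sums *)

Lemma powR_lower (t p : RR) (P : nat) : 0 < t <= 1 -> p <= P%:R -> t ^+ P <= powR t p.
Proof.
move=> t01 pP; have /andP[t0 _] := t01.
by rewrite -(powR_mulrn _ (ltW t0)); apply: (ger_powR t01).
Qed.

Lemma count_large (A : seq Gam) (phi : Gam -> RR) (t M : RR) : 0 <= t ->
  (forall g, phi g <= M) ->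
  \sum_(g <- A) phi g <= M * (count (fun g => t <= phi g) A)%:R + t * (size A)%:R.
Proof.
move=> t0 phiM; elim: A => [|g A IHA] /=; first by rewrite big_nil !mulr0 addr0.
rewrite big_cons natrD -[(size A).+1]add1n natrD !mulrDr mulr1.
have [tg|gt] := leP t (phi g); rewrite ?mulr1 ?mulr0 ?add0r.
  by have := phiM g; lra.
by have := ltW gt; lra.
Qed.

(** Used with [q = 2 ^ -j], [Q = 2 ^ j], [N = 2 ^ (j * j)], [z] the size of [A j] and [b] the number
    of its large values: the small ones account for at most [q * N / 4], half of the guaranteed
    mass. *)
Lemma large_count_bound (R : realFieldType) (q Q N z S b : R) : 0 < q -> q * Q = 1 ->
  q * (N / 2) <= S -> z <= 2 * N -> S <= 4 * b + q / 8 * z -> N <= 16 * b * Q.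
Proof.
move=> q0 qQ NS zN Sb.
have qz : q * z <= q * (2 * N) by rewrite ler_pM2l.
have qN : q * N <= 16 * b by lra.
have Q0 : 0 <= Q by rewrite -(pmulr_rge0 _ q0) qQ.
have -> : N = q * N * Q by rewrite mulrAC qQ mul1r.
exact: ler_wpM2r.
Qed.

Lemma spread_not_lp (phi : Gam -> RR) (A : nat -> seq Gam) (p : RR) :
  (forall g, 0 <= phi g <= 4) ->
  (forall j, [/\ uniq (A j), (size (A j) <= 2 * 2 ^ (j * j))%N &
    2^-1 ^+ j * ((2 ^ (j * j))%:R / 2) <= \sum_(g <- A j) phi g]) ->
  0 < p -> ~ lp p (fun g => Complex (phi g) 0).
Proof.
move=> phi04 AP p0 [M MP].
pose P := Num.bound p; pose K := Num.bound `|M|.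
have pP : p <= P%:R by apply/ltW/archi_boundP/ltW.
have MK : M < (2 ^ K)%:R.
  apply: (le_lt_trans (ler_norm M)); apply: lt_trans (archi_boundP (normr_ge0 M)) _.
  by rewrite ltr_nat ltn_expl.
(* Large enough for [K + (j + 3) * P + (j + 4) <= j * j], so the large values alone contribute at
   least [2 ^ K], more than [M]. *)
pose j := (P + K + 5)%N; have [UA sA sumA] := AP j.
(* The mean of [phi] over [A j] is at least [2 ^ -j / 4]; the threshold is half of that. *)
pose t : RR := 2^-1 ^+ (j + 3).
have t0 : 0 < t by rewrite exprn_gt0 // invr_gt0.
have t1 : t <= 1.
  by apply: exprn_ile1; [rewrite invr_ge0 | rewrite invf_le1 ?ler1n].
pose a := count (fun g => t <= phi g) (A j).
have large : (2 ^ (j * j) <= a * 2 ^ (j + 4))%N.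
  have := count_large (A j) (ltW t0) (fun g => (andP (phi04 g)).2).
  rewrite -/a => cA.
  have qQ : 2^-1 ^+ j * (2 ^ j)%:R = 1 :> RR by rewrite natrX -exprMn mulVf ?expr1n.
  have q0 : 0 < 2^-1 ^+ j :> RR by rewrite exprn_gt0 // invr_gt0.
  have sAR : (size (A j))%:R <= 2 * (2 ^ (j * j))%:R :> RR by rewrite -natrM ler_nat.
  have te : t = 2^-1 ^+ j / 8.
    by rewrite /t exprD; congr (_ * _); rewrite !exprS expr0; field.
  rewrite te in cA.
  have -> : (a * 2 ^ (j + 4) = 16 * a * 2 ^ j)%N by rewrite expnD; lia.
  rewrite -(ler_nat RR) [leRHS]natrM [X in X * _]natrM.
  exact: large_count_bound q0 qQ sumA sAR cA.
have key : (2 ^ K * 2 ^ ((j + 3) * P) <= a)%N.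
  rewrite -(@leq_pmul2r (2 ^ (j + 4))) ?expn_gt0 //; apply: leq_trans large.
  by rewrite -!expnD leq_exp2l // /j; nia.
have := MP [seq g <- A j | t <= phi g] (filter_uniq _ UA).
apply/negP; rewrite -ltNge; apply: lt_le_trans MK _.
apply: le_trans (_ : a%:R * t ^+ P <= _).
  rewrite /t -exprM exprVn ler_pdivlMr ?exprn_gt0 //.
  by rewrite -natrX -natrM ler_nat.
rewrite big_filter.
apply: le_trans (_ : \sum_(g <- A j | t <= phi g) t ^+ P <= _).
  by rewrite big_const_seq iter_addr_0 mulr_natl.
apply: ler_sum => g tg; have /andP[phi0 _] := phi04 g.
rewrite cmod_real ger0_norm //.
apply: le_trans (powR_lower _ pP) _; first by rewrite t0.
by apply: ge0_ler_powR; rewrite ?nnegrE ?(ltW p0) ?(ltW t0).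
Qed.

Theorem theorem1p3 :
  exists G : groupType,
    finitely_generated G /\ torsion_group G /\ Lit G = +oo%E.
Proof.
exists Gam; split; [exact: fg_Gam | split; first exact: torsion_Gam].
have [Phi1 [Phi2 [phi [A [PhiP AP]]]]] := exists_spread_T1.
(* Singleton sums bound [Phi1] and [Phi2] by 2 each. *)
have phi04 g : 0 <= phi g <= 4.
  have [P0 P1 P2 PE] := PhiP [:: 1%g; g].
  have := PE 1%g g; rewrite !inE !eqxx orbT invg1 mul1g => /(_ isT isT) <-.
  have := P1 1%g [:: g] isT; have := P2 g [:: 1%g] isT; rewrite !big_seq1.
  by have [] := P0 1%g g; lra.
(* No exponent is admissible, and the infimum of the empty set is infinite. *)
rewrite /Lit (_ : [set p | _]%classic = classical_sets.set0) ?image_set0 ?ereal_inf0 //.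
apply/seteqP; split=> // p [p0 /(_ _ (T1_of_partial PhiP))].
exact: spread_not_lp.
Qed.
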